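(* For every complete Boolean algebra $B$, the complement graph $G_B=\{(b,\neg b):b\in B\}\subseteq B^2$, equipped with the subspace topology inherited from the Scott space $\Sigma B^2$, is a KC-space.
   Context: For a Boolean algebra $B$, $\neg b$ denotes the complement of $b$, and $B^2=B\times B$ carries the coordinatewise order and operations. A subset $U$ of a poset $P$ is Scott open if it is an upper set and, whenever a directed (in particular nonempty) set $D\subseteq P$ has a supremum with $\bigvee D\in U$, one has $D\cap U\neq\varnothing$. The Scott open sets form the Scott topology on $P$, and $\Sigma P$ denotes $P$ with the Scott topology. A topological space is a KC-space if each of its compact subsets is closed. Compactness means that every open cover has a finite subcover (no separation axiom is assumed). *)

(* Defs.v *)
From HB Require Import structures.
From mathcomp Require Import all_boot all_order.
From mathcomp Require Import all_classical.
From mathcomp Require Import topology.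

Set Implicit Arguments.
Unset Strict Implicit.
Unset Printing Implicit Defensive.

Import Order.TTheory.
Local Open Scope classical_set_scope.
Local Open Scope order_scope.

Section scott_topology.
Context {d : Order.disp_t} (P : porderType d).

Definition directed_set (D : set P) : Prop :=
  D !=set0 /\
  forall x y, D x -> D y -> exists z, [/\ D z, x <= z & y <= z].

Definition upper_set (U : set P) : Prop :=
  forall x y, U x -> x <= y -> U y.

(* Directed sets without a supremum in P impose no condition. *)
Definition scott_open : set (set P) := [set U |
  upper_set U /\
  forall (D : set P) (s : P),
    directed_set D -> isLub D s -> U s -> (D `&` U) !=set0].

Lemma scott_openT : scott_open setT.
Proof. by split=> // D s [[x Dx] _] _ _; exists x. Qed.

Lemma scott_openI : setI_closed scott_open.
Proof.
move=> U V [upU oU] [upV oV]; split=> [x y [Ux Vx] xy|D s dD sD [Us Vs]].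
  by split; [exact: upU xy|exact: upV xy].
have [x [Dx Ux]] := oU D s dD sD Us.
have [y [Dy Vy]] := oV D s dD sD Vs.
have [z [Dz xz yz]] := dD.2 x y Dx Dy.
by exists z; split=> //; split; [exact: upU xz|exact: upV yz].
Qed.

Lemma scott_open_bigU (I : Type) (f : I -> set P) :
  (forall i, scott_open (f i)) -> scott_open (\bigcup_i f i).
Proof.
move=> fo; split=> [x y [i _ fx] xy|D s dD sD [i _ fs]].
  by exists i => //; exact: (fo i).1 xy.
have [x [Dx fx]] := (fo i).2 D s dD sD fs.
by exists x; split=> //; exists i.
Qed.

(* An alias of P, so that the Scott topology does not conflict with a topology
   the library already puts on some ordered types. *)
Definition scott : Type := P.

HB.instance Definition _ := Order.POrder.on scott.
HB.instance Definition _ :=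
  isOpenTopological.Build scott scott_openT scott_openI scott_open_bigU.

Lemma open_scottE : @open scott = scott_open.
Proof. by []. Qed.

End scott_topology.

(* The empty set and the whole of L are allowed, so L is a complete lattice. *)
Definition sup_complete {d : Order.disp_t} (L : porderType d) : Prop :=
  forall A : set L, exists s, isLub A s.

(* *p is the product with the coordinatewise order. *)
Definition compl_graph {d : Order.disp_t} (B : ctbDistrLatticeType d) :
    set (scott (B *p B)) :=
  range (fun b : B => (b, ~` b) : scott (B *p B)).
Arguments compl_graph {d} B.

(* [compact] is defined by filters, and is only known to agree with
   [cover_compact] on pointed spaces. *)
Definition KC_space (T : topologicalType) : Prop :=
  forall K : set T, cover_compact K -> closed K.

(* Main.v *)
Require Import Defs.
From mathcomp Require Import all_boot all_order.
From mathcomp Require Import finmap.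
From mathcomp Require Import all_classical.
From mathcomp Require Import topology.

(** On the graph [G], [(x, y) <= (b, ~` b)] is equivalent to
    [(b, ~` b) <= (~` y, ~` x)], so the traces on [G] of principal up-sets are
    also traces of principal down-sets, hence closed.  If [K] is a compact
    subset of [G] and [D] is a directed subset of the down-closure of [K] with
    supremum [s], the sets of elements of [K] above [p], for [p] in [D], form
    a filtered family of nonempty closed subsets of [K]; a point common to all
    of them lies above [s].  The down-closure of [K] is therefore Scott closed,
    and its trace on [G] is [K] because [G] is an antichain. *)

Import Order.Theory.
Local Open Scope classical_set_scope.
Local Open Scope order_scope.

Section scott_order.
Context {d : Order.disp_t} (P : porderType d).

Lemma directed_set_seq_ub (D : set P) (s : seq P) :
  directed_set D -> (forall p, p \in s -> D p) ->
  exists2 z, D z & forall p, p \in s -> p <= z.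
Proof.
move=> [[x0 Dx0] dirD]; elim: s => [|a s IHs] sD; first by exists x0.
have [z Dz zs] : exists2 z, D z & forall p, p \in s -> p <= z.
  by apply: IHs => p ps; apply: sD; rewrite inE ps orbT.
have [w [Dw aw zw]] := dirD a z (sD a (mem_head a s)) Dz.
exists w => // p; rewrite inE => /predU1P[->//|/zs pz].
exact: le_trans zw.
Qed.

Lemma scott_closed_principal (p : scott P) : closed [set x : scott P | x <= p].
Proof.
rewrite -openC open_scottE; split=> [x y xp xy yp|D s _ [_ lubs] sp].
  by apply: xp; exact: le_trans yp.
apply: contrapT => noD; apply/sp/lubs => x Dx.
by apply: contrapT => xp; apply: noD; exists x.
Qed.

Lemma KC_antichain (G : set (scott P)) :
  (forall x y, G x -> G y -> x <= y -> x = y) ->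
  (forall p : P, closed [set g : set_type G | p <= (set_val g : P)]) ->
  KC_space (set_type G).
Proof.
move=> antiG closedG K compactK.
pose C : set (scott P) := [set x | exists2 g, K g & x <= set_val g].
have -> : K = set_val @^-1` C.
  apply/seteqP; split=> [g Kg|g [h Kh gh]]; first by exists g.
  have /val_inj -> // : set_val g = set_val h.
  by apply: antiG => //; exact: set_valP.
apply: (continuous_closedP _).1; first exact: initial_continuous.
rewrite -openC open_scottE; split=> [x y nCx xy [g Kg yg]|D s dD [_ lubs] nCs].
  by apply: nCx; exists g => //; exact: le_trans yg.
apply: contrapT => noD.
have sDC x : D x -> C x.
  by move=> Dx; apply: contrapT => nCx; apply: noD; exists x.
(* If these open sets did not cover [K], some point of [K] would lie above all of [D], hence above
   [s], against [nCs]. *)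
have [p _|g Kg|A sAD KA] :=
  compactK P D (fun p => ~` [set g | p <= (set_val g : P)]).
- by rewrite openC; exact: closedG.
- apply: contrapT => ncov; apply: nCs; exists g => //; apply: lubs => p Dp.
  by apply: contrapT => npg; apply: ncov; exists p.
(* An upper bound [z] in [D] of the finite set [A] lies below some [g] in [K], and this [g] escapes
   the subcover. *)
have [p pA|z Dz zA] := directed_set_seq_ub D A dD.
  exact/set_mem/sAD.
have [g Kg zg] := sDC z Dz.
have [p pA] := KA g Kg.
by apply; exact: le_trans (zA p pA) zg.
Qed.

End scott_order.

Section compl_graph.
Context {d : Order.disp_t} (B : ctbDistrLatticeType d).

(** Complementation turns the inequality in each coordinate into the one in the other. *)
Lemma le_compl_graph (p g : B *p B) : compl_graph B g ->
  (p <= g) = (g <= ((~` p.2, ~` p.1) : B *p B)).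
Proof. by move=> [b _ <-]; rewrite !leEprod /= leC lexC andbC. Qed.

(** The second coordinate reverses the inequality of the first. *)
Lemma compl_graph_antichain (x y : scott (B *p B)) :
  compl_graph B x -> compl_graph B y -> x <= y -> x = y.
Proof.
move=> [a _ <-] [b _ <-]; rewrite leEprod /= leC => ab.
by rewrite (le_anti ab).
Qed.

Lemma closed_compl_graph_ge (p : B *p B) :
  closed [set g : set_type (compl_graph B) | p <= (set_val g : B *p B)].
Proof.
have -> : [set g : set_type (compl_graph B) | p <= (set_val g : B *p B)] =
    set_val @^-1` [set x : scott (B *p B) | x <= ((~` p.2, ~` p.1) : B *p B)].
  by apply/seteqP; split=> g /=; rewrite (le_compl_graph _ _ (set_valP g)).
apply: (continuous_closedP _).1; first exact: initial_continuous.
exact: scott_closed_principal.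
Qed.

End compl_graph.

(* [set_type A] carries the initial topology of its inclusion in the ambient
   space, here [scott (B *p B)]. *)
Theorem proposition3p3 (d : Order.disp_t) (B : ctbDistrLatticeType d)
    (B_complete : sup_complete B) :
  KC_space (set_type (compl_graph B)).
Proof.
apply: KC_antichain; first exact: compl_graph_antichain.
exact: closed_compl_graph_ge.
Qed.
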